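(* Let $p$ be an Ising model on a graph $G=(V,E)$ with $|V|=n\ge 2$, with no external field, in the $\eta$-high-temperature regime. Let $a=(a_{uv})$ be a real coefficient vector, not identically zero, indexed by unordered pairs of distinct nodes of $V$, let $f_a(x)=\sum_{u,v}a_{uv}x_ux_v$ (sum over unordered pairs of distinct nodes), and let $\|a\|_\infty=\max_{u,v}|a_{uv}|$. If $X\sim p$, then for every $r\ge \frac{300\,\|a\|_\infty\, n\log^2 n}{\eta}+2$, $$\Pr\left[\,|f_a(X)-\mathbf{E}[f_a(X)]|\ge r\,\right]\le 5\exp\left(-\frac{\eta\, r}{1735\,\|a\|_\infty\, n\log n}\right).$$
   Context: Let $G=(V,E)$ be a finite graph with $|V|=n$, with real parameters $(\theta_v)_{v\in V}$ and $(\theta_{uv})_{\{u,v\}\in E}$ (put $\theta_{uv}=0$ if $\{u,v\}\notin E$). The Ising model $p$ on $G$ is the probability distribution on $\{\pm1\}^V$ given by $p(x)=\exp\left(\sum_{v\in V}\theta_vx_v+\sum_{\{u,v\}\in E}\theta_{uv}x_ux_v-\Phi(\vec\theta)\right)$, where $\Phi(\vec\theta)$ is the normalizing constant. It has no external field if $\theta_v=0$ for all $v$. It is in the $\eta$-high-temperature regime (Dobrushin's uniqueness condition) if $\eta>0$ and $\max_{v\in V}\sum_{u\ne v}\tanh(|\theta_{uv}|)\le 1-\eta$. $\log$ is the natural logarithm. *)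

(* Defs.v *)
(* MathComp world, with the reals and exp/ln of MathComp-Analysis. *)
From mathcomp Require Import all_boot all_order all_algebra.
From mathcomp Require Import reals sequences exp.

Set Implicit Arguments.
Unset Strict Implicit.
Unset Printing Implicit Defensive.

Import Order.TTheory GRing.Theory Num.Theory.
Local Open Scope ring_scope.

Definition tanh (R : realType) (t : R) : R :=
  (expR t - expR (- t)) / (expR t + expR (- t)).

(* Unordered pairs of distinct nodes are the two-element subsets of V; families
   indexed by pairs are functions on {set V} that are only read on those. *)
Definition node_pairs (V : finType) : {set {set V}} :=
  [set e : {set V} | #|e| == 2%N].

Record sgraph (V : finType) := SGraph {
  edges : {set {set V}};
  edges_sub : edges \subset node_pairs V
}.

(* The elements of {+1,-1}^V are encoded as boolean functions, true being +1. *)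
Notation config V := {ffun V -> bool}.

Definition spin (R : realType) (V : finType) (x : config V) (v : V) : R :=
  if x v then 1 else -1.

(* x_u x_v for the pair {u, v} *)
Definition pair_spin (R : realType) (V : finType) (x : config V)
    (e : {set V}) : R :=
  \prod_(v in e) spin R x v.

Record ising (R : realType) (V : finType) := Ising {
  graph : sgraph V;
  node_param : V -> R;
  edge_param : {set V} -> R
}.

(* theta_{uv}, extended by zero outside the edge set *)
Definition coupling (R : realType) (V : finType) (p : ising R V) (u v : V) : R :=
  if [set u; v] \in edges (graph p) then edge_param p [set u; v] else 0.

Definition hamiltonian (R : realType) (V : finType) (p : ising R V)
    (x : config V) : R :=
  \sum_(v : V) node_param p v * spin R x v
  + \sum_(e in edges (graph p)) edge_param p e * pair_spin R x e.

Definition log_partition (R : realType) (V : finType) (p : ising R V) : R :=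
  ln (\sum_(x : config V) expR (hamiltonian p x)).

Definition ising_pmf (R : realType) (V : finType) (p : ising R V)
    (x : config V) : R :=
  expR (hamiltonian p x - log_partition p).

Definition Prob (R : realType) (V : finType) (p : ising R V)
    (A : pred (config V)) : R :=
  \sum_(x : config V | A x) ising_pmf p x.

Definition Expect (R : realType) (V : finType) (p : ising R V)
    (f : config V -> R) : R :=
  \sum_(x : config V) ising_pmf p x * f x.

Definition no_external_field (R : realType) (V : finType) (p : ising R V) : Prop :=
  forall v, node_param p v = 0.

(* The row sums are nonnegative, so the neutral element 0 of the iterated maximum
   does not affect its value when V is nonempty. *)
Definition high_temperature (R : realType) (V : finType) (eta : R)
    (p : ising R V) : Prop :=
  0 < eta /\
  \big[Num.max/0]_(v : V) (\sum_(u : V | u != v) tanh `|coupling p u v|)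
    <= 1 - eta.

Definition pair_form (R : realType) (V : finType) (a : {set V} -> R)
    (x : config V) : R :=
  \sum_(e in node_pairs V) a e * pair_spin R x e.

Definition coef_norm (R : realType) (V : finType) (a : {set V} -> R) : R :=
  \big[Num.max/0]_(e in node_pairs V) `|a e|.

(* Main.v *)
Require Import Defs.
From mathcomp Require Import all_boot all_order all_algebra.
From mathcomp Require Import ring lra.
From mathcomp Require Import boolp reals topology normedtype.
From mathcomp Require Import sequences exp derive realfun.

(* Under Dobrushin's condition with constant eta, the heat-bath operator
   contracts the maximal one-spin oscillation by 1 - eta / n; being
   self-adjoint it then contracts the L2 norm of centred functions at the same
   rate, which is the Poincare inequality
     eta Var f <= 1/2 sum_v E (f - f o flip_v)^2.
   The flip derivative of f_a at v is twice a linear form up to sign, and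
   linear forms are centred as there is no external field, so a second use of
   the inequality gives Var f_a <= 4 |a|^2 n^2 / eta^2.
   The measures with density proportional to exp(t f_a) are Ising models with
   pair weights J + t a, and they satisfy Dobrushin's condition with constant
   eta / 2 while 4 t |a| n <= eta. Since d/dt E_t f_a = Var_t f_a, this bounds
   the exponential moments of f_a - E f_a at the scale eta / (|a| n), and the
   Chernoff bound with s = eta / (8 |a| n) concludes. *)

Set Implicit Arguments.
Unset Strict Implicit.
Unset Printing Implicit Defensive.

Import Order.TTheory GRing.Theory Num.Theory.
Import numFieldNormedType.Exports.
Local Open Scope ring_scope.

(** * Hyperbolic tangent: addition formula and increment bounds *)

Section Tanh.
Variable R : realType.
Implicit Types x y t : R.

(** Only [expR t] remains, so identities and bounds become rational in one positive quantity. *)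
Lemma tanhE t : tanh t = 1 - 2 / (expR t ^+ 2 + 1).
Proof.
have e0 := expR_gt0 t; rewrite /tanh expRN; field.
by rewrite !lt0r_neq0//; nra.
Qed.

Lemma tanhN t : tanh (- t) = - tanh t.
Proof. by rewrite /tanh opprK -mulNr opprB [expR (- t) + expR t]addrC. Qed.

Lemma tanh_norm_lt1 t : `|tanh t| < 1.
Proof.
have e0 : 0 < expR t ^+ 2 by rewrite exprn_gt0 ?expR_gt0.
rewrite tanhE ltr_norml; apply/andP; split; last first.
  by rewrite ltrBlDr ltrDl divr_gt0 ?ltr_wpDl ?ltW.
suff: 2 / (expR t ^+ 2 + 1) < 2 by lra.
by rewrite ltr_pdivrMr; nra.
Qed.

Lemma tanh_ge0 t : 0 <= t -> 0 <= tanh t.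
Proof.
move=> t0; rewrite /tanh divr_ge0//; last by rewrite addr_ge0 ?expR_ge0.
by rewrite subr_ge0 ler_expR; lra.
Qed.

Lemma ler_tanh x y : x <= y -> tanh x <= tanh y.
Proof.
move=> xy; rewrite !tanhE lerB// ler_pM2l// lef_pV2 ?posrE ?ltr_wpDl ?sqr_ge0//.
by rewrite lerD2r ler_sqr ?nnegrE ?expR_ge0// ler_expR.
Qed.

Lemma tanh_norm t : tanh `|t| = `|tanh t|.
Proof.
case: (lerP 0 t) => t0; first by rewrite !ger0_norm ?tanh_ge0.
have := @tanh_ge0 (- t); rewrite oppr_ge0 tanhN oppr_ge0 => /(_ (ltW t0)) th0.
by rewrite ltr0_norm// tanhN ler0_norm.
Qed.

Lemma tanhD x y : tanh (x + y) = (tanh x + tanh y) / (1 + tanh x * tanh y).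
Proof.
rewrite !tanhE expRD; set a := expR x; set b := expR y.
have a0 : 0 < a := expR_gt0 x; have b0 : 0 < b := expR_gt0 y.
by field; rewrite !lt0r_neq0//; nra.
Qed.

(** With E = exp(2t) >= 1, one has 1 - 2t <= 1/E <= 2/(E + 1). *)
Lemma tanh_le t : 0 <= t -> tanh t <= 2 * t.
Proof.
move=> t0; have e0 : 0 < expR t ^+ 2 by rewrite exprn_gt0 ?expR_gt0.
have e1 : 1 - 2 * t <= (expR t ^+ 2)^-1.
  rewrite -exprVn -expRN expr2 -expRD (le_trans _ (expR_ge1Dx _))//; lra.
rewrite tanhE lerBlDr -lerBlDl; apply: le_trans e1 _.
rewrite -[leRHS]invf_div lef_pV2 ?posrE//; last by rewrite divr_gt0// addr_gt0.
rewrite ler_pdivrMr//.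
have := expR_ge1Dx t; nra.
Qed.

(** In the addition formula the denominator is at least 1 for nonnegative arguments. This controls
    Dobrushin row sums when the couplings are perturbed. *)
Lemma tanh_normD x y : tanh `|x + y| <= tanh `|x| + 2 * `|y|.
Proof.
apply: le_trans (ler_tanh (ler_normD x y)) _; rewrite tanhD.
have x0 := tanh_ge0 (normr_ge0 x); have y0 := tanh_ge0 (normr_ge0 y).
rewrite (@le_trans _ _ (tanh `|x| + tanh `|y|))// ?lerD2l ?tanh_le//.
by have xy := mulr_ge0 x0 y0; rewrite ler_pdivrMr; nra.
Qed.

(** With a = tanh x and b = tanh y the difference is 2b(1 - a^2)/(1 - a^2 b^2), and the quotient is
    at most 1 because b^2 < 1. It measures how flipping one spin shifts the conditional law of
    another. *)
Lemma tanhD_tanhB x y : `|tanh (x + y) - tanh (x - y)| <= 2 * tanh `|y|.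
Proof.
rewrite !tanhD tanhN tanh_norm.
have := tanh_norm_lt1 x; have := tanh_norm_lt1 y.
move: (tanh x) (tanh y) => a b; rewrite !ltr_norml => /andP[b1 b2] /andP[a1 a2].
have a21 : a ^+ 2 < 1 by nra.
have b21 : b ^+ 2 < 1 by nra.
have ab : (a * b) ^+ 2 < 1.
  by rewrite exprMn (le_lt_trans _ a21)// ler_piMr ?sqr_ge0// ltW.
have p1 : 0 < 1 + a * b by nra.
have p2 : 0 < 1 - a * b by nra.
have -> : (a + b) / (1 + a * b) - (a - b) / (1 + a * - b) =
  2 * (b * ((1 - a ^+ 2) / (1 - (a * b) ^+ 2))).
  by field; rewrite !lt0r_neq0// ?subr_gt0// mulrN.
rewrite normrM (ger0_norm (ler0n R 2)) ler_pM2l// normrM ler_piMr//.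
rewrite ger0_norm; last by rewrite divr_ge0//; nra.
rewrite ler_pdivrMr ?subr_gt0// mul1r exprMn; nra.
Qed.

End Tanh.

(** * Single-spin flips and local fields *)

Section Flip.
Variables (R : realType) (V : finType).
Implicit Types (x y : config V) (u v : V) (J a : {set V} -> R).

Definition flip v x : config V := [ffun u => if u == v then ~~ x u else x u].

Lemma flipK v : involutive (flip v).
Proof.
by move=> x; apply/ffunP => u; rewrite !ffunE; case: eqP => // _; rewrite negbK.
Qed.

Lemma flipC u v x : flip u (flip v x) = flip v (flip u x).
Proof. by apply/ffunP => w; rewrite !ffunE; do 2 case: eqP => //. Qed.

Lemma sum_flip v (F : config V -> R) : \sum_x F (flip v x) = \sum_x F x.
Proof.
by rewrite [RHS](reindex (flip v))//; exists (flip v) => x _; rewrite flipK.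
Qed.

Lemma spin_flip v x u :
  spin R (flip v x) u = if u == v then - spin R x u else spin R x u.
Proof.
by rewrite /spin ffunE; case: eqP => // _; case: (x u); rewrite ?opprK.
Qed.

Lemma spin_sqr x u : spin R x u ^+ 2 = 1.
Proof. by rewrite /spin; case: (x u); rewrite ?sqrrN expr1n. Qed.

Lemma spin_norm x u : `|spin R x u| = 1.
Proof. by rewrite /spin; case: (x u); rewrite ?normrN normr1. Qed.

Lemma pair_spin2 x u v : u != v ->
  pair_spin R x [set u; v] = spin R x u * spin R x v.
Proof. by move=> uv; rewrite /pair_spin big_setU1 ?inE//= big_set1. Qed.

(** Under the Gibbs measure with couplings [J], the conditional mean of the spin at [v] is [tanh] of
    this field. *)
Definition local_field J v x := \sum_(u | u != v) J [set u; v] * spin R x u.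

Lemma sum_pairs_at v (F : {set V} -> R) :
  \sum_(e in node_pairs V | v \in e) F e = \sum_(u | u != v) F [set u; v].
Proof.
(* The inverse map picks the endpoint of [e] other than [v]; the default [v] is never reached on a
   two-element set containing [v]. *)
rewrite (reindex_onto (fun u => [set u; v])
          (fun e => odflt v [pick u in e :\ v])) /=; last first.
  move=> e; rewrite inE => /andP[/cards2P[a [b [ab ->]]]].
  case: pickP => [u|]; last first.
    move=> n; rewrite !inE => /orP[]/eqP vE; [have := n b|have := n a];
    by rewrite !inE vE eqxx ?orbT ?andbT ?[b == a]eq_sym ab.
  rewrite !inE => /andP[uv /orP[]/eqP uE] /orP[]/eqP vE; subst u v.
  - by rewrite eqxx in uv.
  - by [].
  - by rewrite setUC.
  - by rewrite eqxx in uv.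
apply: eq_bigl => u; rewrite !inE eqxx orbT andbT cards2.
have [->|uv] := eqVneq u v; first by rewrite setUid.
rewrite eqxx/=; case: pickP => [w|]/=.
  by rewrite !inE => /andP[/negPf wv]; rewrite wv orbF => /eqP->; rewrite eqxx.
by move/(_ u); rewrite !inE uv eqxx.
Qed.

(** Only the pairs through [v] change sign. They sum to the spin at [v] times its local field, which
    does not see that spin. *)
Lemma pair_form_flip J v x :
  pair_form J (flip v x) = pair_form J x - 2 * (spin R x v * local_field J v x).
Proof.
have split y : pair_form J y = spin R y v * local_field J v y +
    \sum_(e in node_pairs V | v \notin e) J e * pair_spin R y e.
  rewrite /pair_form (bigID (fun e : {set V} => v \in e))/=; congr (_ + _).
  rewrite sum_pairs_at mulr_sumr; apply: eq_bigr => u uv.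
  by rewrite pair_spin2//; ring.
rewrite !split spin_flip eqxx.
have -> : local_field J v (flip v x) = local_field J v x.
  by apply: eq_bigr => u /negPf uv; rewrite spin_flip uv.
have -> : \sum_(e in node_pairs V | v \notin e) J e * pair_spin R (flip v x) e
    = \sum_(e in node_pairs V | v \notin e) J e * pair_spin R x e.
  apply: eq_bigr => e /andP[_ ve]; congr (_ * _); apply: eq_bigr => u ue.
  by rewrite spin_flip; case: eqP => // uv; rewrite -uv ue in ve.
ring.
Qed.

Lemma local_field_flip J u v x : u != v ->
  local_field J v (flip u x) =
  local_field J v x - 2 * (J [set u; v] * spin R x u).
Proof.
move=> uv; rewrite /local_field (bigD1 u)//= [X in _ = X - _](bigD1 u)//=.
rewrite spin_flip eqxx; under eq_bigr => w /andP[_ /negPf wu].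
  rewrite spin_flip wu; over.
ring.
Qed.

Lemma local_field_flip_id J v x :
  local_field J v (flip v x) = local_field J v x.
Proof. by apply: eq_bigr => u /negPf uv; rewrite spin_flip uv. Qed.

End Flip.

(** * Cauchy-Schwarz and log-convex sequences *)

Section RealInequalities.
Variable R : realType.

(** Lagrange's identity: twice the gap is a weighted double sum of squares. *)
Lemma sum_Cauchy_Schwarz (I : finType) (w f g : I -> R) :
  (forall i, 0 <= w i) ->
  (\sum_i w i * (f i * g i)) ^+ 2 <=
  (\sum_i w i * (f i * f i)) * (\sum_i w i * (g i * g i)).
Proof.
move=> w0; set A := \sum_i w i * (f i * f i); set B := \sum_i w i * (g i * g i).
set C := \sum_i _.
have sq : A * B + B * A - 2 * (C * C)
    = \sum_i \sum_j w i * w j * (f i * g j - f j * g i) ^+ 2.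
  rewrite !big_distrlr/= mulr_sumr -big_split -sumrB/=; apply: eq_bigr => i _.
  rewrite mulr_sumr -big_split -sumrB/=; apply: eq_bigr => j _; ring.
suff : 0 <= A * B + B * A - 2 * (C * C) by nra.
rewrite sq; apply: sumr_ge0 => i _; apply: sumr_ge0 => j _.
by rewrite mulr_ge0 ?sqr_ge0// mulr_ge0.
Qed.

Lemma Bernoulli (s : R) k : 0 <= s -> 1 + k%:R * (s - 1) <= s ^+ k.
Proof.
move=> s0; elim: k => [|k IH]; first by rewrite mul0r addr0.
have k0 : 0 <= k%:R :> R by [].
rewrite exprS; apply: le_trans (ler_wpM2l s0 IH).
rewrite -natr1; have := mulr_ge0 k0 (sqr_ge0 (s - 1)); nra.
Qed.

(* For a log-convex sequence the successive ratios increase, so the first one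
   is at most the asymptotic rate. *)
Lemma log_convex_ratio (b : nat -> R) (C q : R) :
  0 <= q -> (forall k, 0 <= b k) ->
  (forall k, b k.+1 ^+ 2 <= b k * b k.+2) ->
  (forall k, b k <= C * q ^+ k) -> b 1%N <= q * b 0%N.
Proof.
move=> q0 b0 bconv bC; rewrite leNgt; apply/negP => b1.
have b1_gt0 : 0 < b 1%N by apply: le_lt_trans b1; rewrite mulr_ge0.
have b0_gt0 : 0 < b 0%N.
  rewrite lt_neqAle b0 andbT eq_sym; apply/eqP => b00.
  by have := bconv 0%N; rewrite b00 mul0r; nra.
have q_gt0 : 0 < q.
  rewrite lt_neqAle q0 andbT eq_sym; apply/eqP => q00.
  by have := bC 1%N; rewrite q00 expr1 mulr0; lra.
set t := b 1%N / b 0%N.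
have tq : q < t by rewrite ltr_pdivlMr.
have step k : 0 < b k /\ t * b k <= b k.+1.
  elim: k => [|k [bk tbk]]; first by rewrite /t divfK ?gt_eqF.
  have bk1 : 0 < b k.+1.
    by apply: lt_le_trans tbk; rewrite mulr_gt0// (lt_trans q_gt0).
  split=> //; rewrite -(ler_pM2l bk); apply: le_trans (bconv k).
  by rewrite mulrCA mulrA expr2 ler_pM2r.
have tb k : t ^+ k * b 0%N <= b k.
  elim: k => [|k IH]; first by rewrite mul1r.
  apply: le_trans (step k).2; rewrite exprS -mulrA ler_pM2l//.
  exact: lt_trans tq.
have s1 : 1 < t / q by rewrite ltr_pdivlMr ?mul1r.
have sC k : (t / q) ^+ k <= C / b 0%N.
  rewrite ler_pdivlMr// exprMn exprVn mulrAC ler_pdivrMr ?exprn_gt0//.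
  exact: le_trans (tb k) (bC k).
have C0 : 0 <= C / b 0%N by apply: le_trans (sC 0%N).
have s1' : 0 < t / q - 1 by rewrite subr_gt0.
(* At this [k] Bernoulli's inequality pushes the power of t / q above the bound C / b 0 that [sC]
   imposes on all powers. *)
have := archi_boundP (divr_ge0 C0 (ltW s1')).
set k := Num.bound _; rewrite ltr_pdivrMr// => kC.
have s0 : 0 <= t / q by apply: le_trans (ltW s1).
by have := le_trans (Bernoulli k s0) (sC k); lra.
Qed.

End RealInequalities.

(** * Gibbs measures and the heat-bath operator *)

Section Gibbs.
Variables (R : realType) (V : finType) (J : {set V} -> R).
Implicit Types (x y : config V) (u v : V) (f g : config V -> R).

Definition weight x := expR (pair_form J x).
Definition partition_fun := \sum_x weight x.
Definition gibbs x := weight x / partition_fun.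
Definition mean f := \sum_x gibbs x * f x.
Definition inner f g := \sum_x gibbs x * (f x * g x).

Lemma partition_fun_gt0 : 0 < partition_fun.
Proof.
rewrite /partition_fun (bigD1 [ffun=> true])//= ltr_wpDr ?expR_gt0//.
by apply: sumr_ge0 => x _; rewrite expR_ge0.
Qed.

Lemma gibbs_ge0 x : 0 <= gibbs x.
Proof. by rewrite divr_ge0 ?expR_ge0// ltW ?partition_fun_gt0. Qed.

Lemma sum_gibbs : \sum_x gibbs x = 1.
Proof. by rewrite -mulr_suml divff// gt_eqF ?partition_fun_gt0. Qed.

Lemma inner_ge0 f : 0 <= inner f f.
Proof.
by apply: sumr_ge0 => x _; rewrite mulr_ge0 ?gibbs_ge0// -expr2 sqr_ge0.
Qed.

Lemma innerC f g : inner f g = inner g f.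
Proof. by apply: eq_bigr => x _; rewrite [f x * _]mulrC. Qed.

(* Probability that resampling the spin at [v] changes it. *)
Definition flip_prob v x := (1 - spin R x v * tanh (local_field J v x)) / 2.

(* Conditional expectation of [f] given the spins other than [v]. *)
Definition resample v f x := f x - flip_prob v x * (f x - f (flip v x)).

Lemma flip_prob_itv v x : 0 <= flip_prob v x <= 1.
Proof.
have := tanh_norm_lt1 (local_field J v x); rewrite ltr_norml => /andP[t1 t2].
by rewrite /flip_prob /spin; case: (x v); apply/andP; split; lra.
Qed.

(** Detailed balance. With z the spin at [v] times its local field, the flip multiplies the weight
    by exp(-2z), while [flip_prob] equals 1/(1 + exp(2z)) and z changes sign. *)
Lemma gibbs_flip_prob v x :
  gibbs (flip v x) * flip_prob v (flip v x) = gibbs x * flip_prob v x.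
Proof.
rewrite /gibbs /flip_prob ![_ / partition_fun * _]mulrAC; congr (_ * _).
rewrite spin_flip eqxx local_field_flip_id /weight pair_form_flip.
move: (local_field J v x) => h; rewrite [LHS]mulrA [RHS]mulrA; congr (_ / 2).
rewrite expRB -mulrA; congr (_ * _); rewrite tanhE.
have e0 := expR_gt0 h; rewrite /spin; case: (x v).
  rewrite !mul1r -[2 * h]/((1 + 1) * h) mulrDl mul1r expRD.
  by field; rewrite !lt0r_neq0//; nra.
rewrite !mulN1r mulrN expRN invrK -[2 * h]/((1 + 1) * h) mulrDl mul1r expRD.
by field; rewrite !lt0r_neq0//; nra.
Qed.

(* Detailed balance makes the jump rate [gibbs * flip_prob] invariant under the
   flip, so the Dirichlet form can be symmetrised. *)
Lemma inner_resample v f g :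
  inner (resample v f) g = inner f g - 2^-1 *
  \sum_x gibbs x * flip_prob v x *
    ((f x - f (flip v x)) * (g x - g (flip v x))).
Proof.
set D := \sum_x _.
have -> : D = 2 * \sum_x gibbs x * flip_prob v x * ((f x - f (flip v x)) * g x).
  rewrite mulr_natl mulr2n -[X in _ + X](sum_flip v) -big_split/=.
  by apply: eq_bigr => x _; rewrite flipK gibbs_flip_prob; ring.
rewrite mulKf ?pnatr_eq0// -sumrB; apply: eq_bigr => x _.
by rewrite /resample; ring.
Qed.

Lemma resample_flip v f x : resample v f (flip v x) = resample v f x.
Proof.
by rewrite /resample flipK /flip_prob spin_flip eqxx local_field_flip_id; field.
Qed.

Definition glauber f x := (\sum_v resample v f x) / #|V|%:R.

Hypothesis V_gt0 : (0 < #|V|)%N.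

(** The subtracted term is the Dirichlet form. It is symmetric and vanishes when [g] is constant,
    which yields self-adjointness and stationarity. *)
Lemma inner_glauber f g :
  inner (glauber f) g = inner f g - (2 * #|V|%:R)^-1 * \sum_v
  \sum_x gibbs x * flip_prob v x *
    ((f x - f (flip v x)) * (g x - g (flip v x))).
Proof.
have V0 : #|V|%:R != 0 :> R by rewrite pnatr_eq0 -lt0n.
have -> : inner (glauber f) g = #|V|%:R^-1 * \sum_v inner (resample v f) g.
  rewrite exchange_big mulr_sumr/=; apply: eq_bigr => x _.
  rewrite -mulr_sumr -mulr_suml /glauber; ring.
under eq_bigr => v _ do rewrite inner_resample.
rewrite sumrB sumr_const -mulr_sumr -[_ *+ #|V|]mulr_natl.
by field.
Qed.

Lemma inner_glauberC f g : inner (glauber f) g = inner f (glauber g).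
Proof.
rewrite [RHS]innerC !inner_glauber innerC; congr (_ - _ * _).
by apply: eq_bigr => v _; apply: eq_bigr => x _; rewrite [_ * (g x - _)]mulrC.
Qed.

Lemma mean_glauber f : mean (glauber f) = mean f.
Proof.
have meanE h : mean h = inner h (fun=> 1).
  by apply: eq_bigr => x _; rewrite mulr1.
rewrite !meanE inner_glauber.
rewrite big1 ?mulr0 ?subr0// => v _.
by rewrite big1// => x _; rewrite subrr !mulr0.
Qed.

(** * One-spin oscillations, contraction and the Poincare inequality *)

Definition flip_lipschitz (M : R) f := forall u x, `|f x - f (flip u x)| <= M.

Lemma flip_lipschitz_exists f : exists M, flip_lipschitz M f.
Proof.
exists (2 * \sum_x `|f x|) => u x.
have fle y : `|f y| <= \sum_x `|f x|.
  by rewrite (bigD1 y)//= lerDl sumr_ge0.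
apply: le_trans (ler_normB _ _) _.
by have := fle x; have := fle (flip u x); lra.
Qed.

(** Induction on the Hamming distance: flip one disagreeing spin at a time. *)
Lemma flip_lipschitz_dist M f x y : flip_lipschitz M f ->
  `|f x - f y| <= #|V|%:R * M.
Proof.
move=> fM.
have M0 : 0 <= M.
  by have /card_gt0P[u _] := V_gt0; apply: le_trans (fM u x).
suff: `|f x - f y| <= #|[set u | x u != y u]|%:R * M.
  by move=> /le_trans; apply; rewrite ler_wpM2r// ler_nat max_card.
have [k kE] : exists k, #|[set u | x u != y u]| = k by eexists.
rewrite kE; elim: k x kE => [|k IH] x kE.
  have -> : x = y.
    apply/ffunP => u; apply/eqP; move/cards0_eq/setP/(_ u): kE.
    by rewrite !inE => /negbFE.
  by rewrite subrr normr0 mul0r.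
have [u uxy] : exists u, u \in [set u | x u != y u].
  by apply/card_gt0P; rewrite kE.
have kE' : #|[set w | flip u x w != y w]| = k.
  apply/eqP; rewrite -eqSS -kE (cardsD1 u [set w | x w != y w]) uxy eqSS.
  apply/eqP; congr #|pred_of_set _|; apply/setP => w; rewrite !inE ffunE.
  have [->|//] := eqVneq w u.
  by move: uxy; rewrite inE; case: (x u); case: (y u).
rewrite -natr1 mulrDl mul1r [_ + M]addrC.
apply: (le_trans (ler_distD (f (flip u x)) (f x) (f y))).
by rewrite lerD ?IH.
Qed.

(** A centred [f x] is the average over y of f x - f y. This turns decay of the oscillation into
    decay of the L2 norm. *)
Lemma inner_le_lipschitz M f : mean f = 0 -> flip_lipschitz M f ->
  inner f f <= (#|V|%:R * M) ^+ 2.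
Proof.
move=> f0 fM; rewrite -[leRHS]mul1r -[X in _ <= X * _]sum_gibbs mulr_suml.
apply: ler_sum => x _; apply: ler_wpM2l; rewrite ?gibbs_ge0// -expr2.
rewrite -ler_sqrt ?sqr_ge0// !sqrtr_sqr.
apply: le_trans _ (ler_norm _).
have -> : f x = \sum_y gibbs y * (f x - f y).
  under eq_bigr do rewrite mulrBr.
  by rewrite sumrB -mulr_suml sum_gibbs mul1r -/(mean f) f0 subr0.
apply: le_trans (ler_norm_sum _ _ _) _.
rewrite -[leRHS]mul1r -[X in _ <= X * _]sum_gibbs mulr_suml.
apply: ler_sum => y _.
rewrite normrM ger0_norm ?gibbs_ge0//; apply: ler_wpM2l; first exact: gibbs_ge0.
exact: flip_lipschitz_dist.
Qed.

(** The spin at [u] enters twice: through [f] itself, at cost [M], and through the law of the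
    resampled spin at [v], which moves by at most [tanh] of the coupling. *)
Lemma resample_lipschitz M f u v x : u != v -> flip_lipschitz M f ->
  `|resample v f x - resample v f (flip u x)| <= (1 + tanh `|J [set u; v]|) * M.
Proof.
move=> uv fM; have vu : v != u by rewrite eq_sym.
set p := flip_prob v x; set q := flip_prob v (flip u x).
have /andP[p0 p1] : 0 <= p <= 1 by exact: flip_prob_itv.
have pq : `|p - q| <= tanh `|J [set u; v]|.
  (* The two values of the local field at [v], before and after the flip at [u], are written as a
     midpoint plus or minus the coupling term. *)
  have := tanhD_tanhB (local_field J v x - J [set u; v] * spin R x u)
            (J [set u; v] * spin R x u).
  rewrite subrK normrM spin_norm mulr1 /p /q /flip_prob spin_flip (negPf vu).
  have -> : local_field J v (flip u x) =
      local_field J v x - J [set u; v] * spin R x u - J [set u; v] * spin R x u.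
    by rewrite local_field_flip//; ring.
  set s := spin R x v.
  move: (tanh (local_field _ _ _)) (tanh (_ - _)) => S T ST.
  have -> : (1 - s * S) / 2 - (1 - s * T) / 2 = - (s * ((S - T) / 2)) by field.
  rewrite normrN normrM spin_norm mul1r normrM [`|2^-1|]ger0_norm ?invr_ge0//.
  by rewrite ler_pdivrMr// mulrC.
(* A convex combination of differences of [f] along [u], plus the change in flip probability times a
   difference of [f] along [v]. *)
rewrite [X in `|X|](_ : _ =
  (1 - p) * (f x - f (flip u x)) + p * (f (flip v x) - f (flip u (flip v x)))
  + (q - p) * (f (flip u x) - f (flip v (flip u x)))); last first.
  by rewrite /resample -/p -/q [flip u (flip v x)]flipC; ring.
clearbody p q; apply: le_trans (ler_normD _ _) _; rewrite [leRHS]mulrDl.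
apply: lerD; last by rewrite normrM distrC ler_pM.
apply: le_trans (ler_normD _ _) _; rewrite !normrM.
rewrite (ger0_norm p0) ger0_norm ?subr_ge0//.
have := fM u x; have := fM u (flip v x); nra.
Qed.

Definition dobrushin eta := forall v,
  \sum_(u | u != v) tanh `|J [set u; v]| <= 1 - eta.

Variable eta : R.
Hypothesis J_dobrushin : dobrushin eta.

Let rho := 1 - eta / #|V|%:R.

(** Resampling [u] erases the dependence on the spin at [u]. The other n - 1 vertices contribute at
    most (n - 1 + 1 - eta) M in total, and dividing by n gives rho M. *)
Lemma glauber_lipschitz M f : flip_lipschitz M f ->
  flip_lipschitz (rho * M) (glauber f).
Proof.
move=> fM u x; have V0 : 0 < #|V|%:R :> R by rewrite ltr0n.
have M0 : 0 <= M by apply: le_trans (fM u x).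
rewrite /glauber -mulrBl -sumrB normrM [`|_^-1|]ger0_norm ?invr_ge0//.
rewrite ler_pdivrMr// (bigD1 u)//= resample_flip subrr add0r.
apply: le_trans (ler_norm_sum _ _ _) _.
apply: (@le_trans _ _ (\sum_(v | v != u) (1 + tanh `|J [set v; u]|) * M)).
  by apply: ler_sum => v vu; rewrite setUC resample_lipschitz// eq_sym.
rewrite -mulr_suml big_split/= sumr_const cardC1 /rho mulrAC ler_wpM2r//.
rewrite mulrBl divfK ?gt_eqF// mul1r; have := J_dobrushin u.
have : #|V|%:R = #|V|.-1%:R + 1 :> R by rewrite natr1 prednK.
lra.
Qed.

(** Row sums are nonnegative, so eta <= 1 <= [#|V|]. *)
Lemma rho_ge0 : 0 <= rho.
Proof.
have V1 : 1 <= #|V|%:R :> R by rewrite ler1n.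
have /card_gt0P[v _] := V_gt0.
have : 0 <= \sum_(u | u != v) tanh `|J [set u; v]|.
  by apply: sumr_ge0 => u _; rewrite tanh_ge0.
move=> /le_trans /(_ (J_dobrushin v)) ?.
by rewrite subr_ge0 ler_pdivrMr; lra.
Qed.

(** By self-adjointness and Cauchy-Schwarz the squared norms of the iterates form a log-convex
    sequence. Contraction of the oscillation bounds it by a constant times rho^(2k), so
    [log_convex_ratio] controls the very first ratio. *)
Lemma glauber_contracts f : mean f = 0 ->
  inner (glauber f) (glauber f) <= rho ^+ 2 * inner f f.
Proof.
move=> f0; have [M fM] := flip_lipschitz_exists f.
have it0 k : mean (iter k glauber f) = 0.
  by elim: k => //= k IH; rewrite mean_glauber.
have itM k : flip_lipschitz (rho ^+ k * M) (iter k glauber f).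
  elim: k => [|k IH] /=; rewrite ?mul1r// exprS -mulrA.
  exact: glauber_lipschitz.
apply: (@log_convex_ratio R
  (fun k => inner (iter k glauber f) (iter k glauber f)) ((#|V|%:R * M) ^+ 2)).
- exact: sqr_ge0.
- by move=> k; exact: inner_ge0.
- move=> k /=; rewrite [X in X ^+ 2]inner_glauberC.
  by apply: sum_Cauchy_Schwarz => x; exact: gibbs_ge0.
- move=> k; apply: le_trans (inner_le_lipschitz (it0 k) (itM k)) _.
  by rewrite !exprMn -[rho ^+ k * _]expr2 mulrCA mulrC.
Qed.

(** Contraction and Cauchy-Schwarz bound the inner product of [glauber f] with [f] by rho times that
    of [f] with itself. Subtracting leaves the Dirichlet form, where each flip probability is at
    most 1. *)
Lemma poincare f : mean f = 0 ->
  eta * inner f f <= 2^-1 * \sum_v mean (fun x => (f x - f (flip v x)) ^+ 2).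
Proof.
move=> f0; have V0 : 0 < #|V|%:R :> R by rewrite ltr0n.
have ff0 := inner_ge0 f.
have gap : inner (glauber f) f <= rho * inner f f.
  rewrite (le_trans (ler_norm _))// -[leRHS]ger0_norm ?mulr_ge0 ?rho_ge0//.
  rewrite -!sqrtr_sqr ler_sqrt ?sqr_ge0//.
  apply: le_trans (sum_Cauchy_Schwarz _ _ gibbs_ge0) _.
  apply: le_trans (ler_wpM2r ff0 (glauber_contracts f0)) _.
  by rewrite exprMn mulrA.
move: gap; rewrite inner_glauber /rho mulrBl mul1r lerD2l lerN2.
set D := \sum_v _ => gap.
apply: (@le_trans _ _ (2^-1 * D)).
  move: gap; rewrite -(ler_pM2l V0) => gap.
  apply: (le_trans (le_trans _ gap)); rewrite le_eqVlt; apply/orP; left;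
    apply/eqP.
    by field; rewrite gt_eqF.
  by field; rewrite gt_eqF.
rewrite ler_pM2l ?invr_gt0//; apply: ler_sum => v _; apply: ler_sum => x _.
have /andP[q0 q1] := flip_prob_itv v x.
by rewrite -expr2 ler_wpM2r ?sqr_ge0// ler_piMr ?gibbs_ge0.
Qed.

End Gibbs.

(** * Variance bounds for linear and quadratic forms *)

Section Variance.
Variables (R : realType) (V : finType) (J : {set V} -> R) (eta : R).
Implicit Types (x : config V) (u v : V) (a : {set V} -> R).
Hypotheses (V_gt0 : (0 < #|V|)%N) (eta_gt0 : 0 < eta).
Hypothesis J_dobrushin : dobrushin J eta.

Lemma meanZ (c : R) (f : config V -> R) :
  mean J (fun x => c * f x) = c * mean J f.
Proof. by rewrite /mean mulr_sumr; apply: eq_bigr => x _; rewrite mulrCA. Qed.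

(** Reversing all spins preserves every pair product, hence the measure. *)
Lemma mean_spin u : mean J (fun x => spin R x u) = 0.
Proof.
pose neg x : config V := [ffun w => ~~ x w].
have negK : involutive neg by move=> x; apply/ffunP => w; rewrite !ffunE negbK.
have spin_neg x w : spin R (neg x) w = - spin R x w.
  by rewrite /spin ffunE; case: (x w); rewrite ?opprK.
have form_neg x : pair_form J (neg x) = pair_form J x.
  apply: eq_bigr => e; rewrite inE => /cards2P[w [w' [ww' ->]]].
  by rewrite !pair_spin2// !spin_neg mulrNN.
have : mean J (fun x => spin R x u) = - mean J (fun x => spin R x u).
  rewrite {1}/mean (reindex neg)/=; last by exists neg => x _; rewrite negK.
  rewrite -sumrN; apply: eq_bigr => x _.
  by rewrite /gibbs /weight form_neg spin_neg mulrN.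
lra.
Qed.

Lemma mean_linear_form (b : V -> R) (P : pred V) :
  mean J (fun x => \sum_(u | P u) b u * spin R x u) = 0.
Proof.
rewrite /mean; under eq_bigr do rewrite mulr_sumr.
rewrite exchange_big big1//= => u _.
by rewrite -/(mean J (fun x => b u * spin R x u)) meanZ mean_spin mulr0.
Qed.

Lemma mean_cst (c : R) : mean J (fun=> c) = c.
Proof. by rewrite /mean -mulr_suml sum_gibbs mul1r. Qed.

(** The form is centred, and a flip at [v] with [P v] moves it by 2 |b v|; half the sum of the
    squares gives the factor 2. *)
Lemma variance_linear_form (b : V -> R) (P : pred V) :
  eta * mean J (fun x => (\sum_(u | P u) b u * spin R x u) ^+ 2)
  <= 2 * \sum_(u | P u) b u ^+ 2.
Proof.
set l := fun x => \sum_(u | P u) b u * spin R x u.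
have l0 : mean J l = 0 by exact: mean_linear_form.
have -> : mean J (fun x => l x ^+ 2) = inner J l l by [].
apply: le_trans (poincare V_gt0 J_dobrushin l0) _.
rewrite mulrC ler_pdivrMr// mulrAC mulr_sumr [leRHS]big_mkcond/=.
apply: ler_sum => v _.
rewrite -[leRHS](mean_cst); apply: ler_sum => x _.
apply: ler_wpM2l; first exact: gibbs_ge0.
have -> : l x - l (flip v x) = if P v then 2 * (b v * spin R x v) else 0.
  rewrite /l -sumrB (bigID (pred1 v))/= [X in _ + X]big1 ?addr0; last first.
    by move=> u /andP[_ /negPf uv]; rewrite spin_flip uv subrr.
  case: ifP => Pv; last first.
    by rewrite big1// => u /andP[Pu /eqP uv]; rewrite uv Pv in Pu.
  rewrite (big_pred1 v) => [|u /=]; last first.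
    by case: eqP => [->|]; rewrite ?Pv ?andbF.
  by rewrite spin_flip eqxx; ring.
case: ifP => _; last by rewrite expr0n.
by rewrite !exprMn spin_sqr mulr1; lra.
Qed.

(** Each local field has second moment at most 2 n A^2 / eta. The squared flip derivative is 4 times
    the squared field, so the second use of [poincare] gives half of 4 * n * 2 n A^2, with one more
    factor 1 / eta. *)
Lemma variance_pair_form a (A : R) :
  (forall e, e \in node_pairs V -> `|a e| <= A) ->
  eta ^+ 2 * mean J (fun x => (pair_form a x - mean J (pair_form a)) ^+ 2)
  <= 4 * A ^+ 2 * #|V|%:R ^+ 2.
Proof.
move=> aA; set m := mean J (pair_form a).
set f := fun x => pair_form a x - m.
have f0 : mean J f = 0.
  rewrite /mean; under eq_bigr do rewrite mulrBr.
  by rewrite sumrB -/(mean J _) -/m -/(mean J (fun=> m)) mean_cst subrr.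
have -> : mean J (fun x => f x ^+ 2) = inner J f f by [].
have fields v : eta * mean J (fun x => (local_field a v x) ^+ 2)
    <= 2 * (#|V|%:R * A ^+ 2).
  apply: le_trans (variance_linear_form _ _) _; rewrite ler_pM2l//.
  rewrite mulr_natl -[#|V|]/#|xpredT| -sumr_const big_mkcond/=.
  apply: ler_sum => u _; case: ifP => uv; last exact: sqr_ge0.
  have {}aA : `|a [set u; v]| <= A by rewrite aA// inE cards2 uv.
  by rewrite -real_normK ?num_real// lerXn2r ?nnegrE// (le_trans _ aA).
have := poincare V_gt0 J_dobrushin f0.
have -> : \sum_v mean J (fun x => (f x - f (flip v x)) ^+ 2)
    = 4 * \sum_v mean J (fun x => (local_field a v x) ^+ 2).
  rewrite mulr_sumr; apply: eq_bigr => v _; rewrite -meanZ.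
  apply: eq_bigr => x _; congr (_ * _).
  rewrite /f pair_form_flip.
  transitivity (4 * (spin R x v ^+ 2 * local_field a v x ^+ 2)); first by ring.
  by rewrite spin_sqr mul1r.
rewrite -(ler_pM2l eta_gt0) mulrA -expr2 => /le_trans; apply.
rewrite mulrA mulrCA.
have : eta * \sum_v mean J (fun x => local_field a v x ^+ 2)
    <= #|V|%:R * (2 * (#|V|%:R * A ^+ 2)).
  rewrite mulr_sumr mulr_natl -[#|V|]/#|xpredT| -sumr_const.
  exact: ler_sum.
lra.
Qed.

End Variance.

(** * Exponential tilting, exponential moments and tails *)

Section Perturbation.
Variables (R : realType) (V : finType).
Implicit Types (x : config V) (J a : {set V} -> R).

Definition tilt J a (s : R) : {set V} -> R := fun e => J e + s * a e.

Lemma pair_form_tilt J a s x :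
  pair_form (tilt J a s) x = pair_form J x + s * pair_form a x.
Proof.
by rewrite mulr_sumr -big_split; apply: eq_bigr => e _; rewrite mulrDl mulrA.
Qed.

(** Each of the n - 1 terms of a row grows by at most 2 s A, hence the row by at most eta / 2. *)
Lemma dobrushin_tilt J a (eta A s : R) :
  dobrushin J eta -> (forall e, e \in node_pairs V -> `|a e| <= A) ->
  0 <= A -> 0 <= s -> 4 * s * A * #|V|%:R <= eta ->
  dobrushin (tilt J a s) (eta / 2).
Proof.
move=> Jeta aA A0 s0 sA v.
apply: (@le_trans _ _ (\sum_(u | u != v) (tanh `|J [set u; v]| + 2 * (s * A)))).
  apply: ler_sum => u uv; apply: le_trans (tanh_normD _ _) _.
  rewrite lerD2l ler_pM2l// normrM ger0_norm// ler_wpM2l// aA//.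
  by rewrite inE cards2 uv.
rewrite big_split/= sumr_const cardC1 -[_ *+ #|V|.-1]mulr_natl.
have n1 : #|V|.-1%:R <= #|V|%:R :> R by rewrite ler_nat leq_pred.
have := Jeta v; have := ler_wpM2r (mulr_ge0 s0 A0) n1; lra.
Qed.

Lemma is_derive_fsum (I : finType) (h dh : I -> R -> R) (s : R) :
  (forall i, is_derive s (1 : R) (h i) (dh i s)) ->
  is_derive s (1 : R) (fun t => \sum_i h i t) (\sum_i dh i s).
Proof.
move=> hP; elim: (index_enum I) => [|i r IH].
  rewrite big_nil; under [X in is_derive _ _ X]funext do rewrite big_nil.
  exact: is_derive_cst.
rewrite big_cons; under [X in is_derive _ _ X]funext do rewrite big_cons.
exact: is_deriveD.
Qed.

Lemma mean_tilt J a s (g : config V -> R) : mean (tilt J a s) g =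
  (\sum_x weight J x * g x * expR (s * pair_form a x))
  / (\sum_x weight J x * expR (s * pair_form a x)).
Proof.
have wE x : weight (tilt J a s) x = weight J x * expR (s * pair_form a x).
  by rewrite /weight pair_form_tilt expRD.
rewrite mulr_suml; apply: eq_bigr => x _; rewrite /gibbs wE /partition_fun.
under [X in _ / X]eq_bigr do rewrite wE.
by rewrite mulrAC [weight J x * _ * _]mulrAC.
Qed.

Lemma is_derive_mean_tilt J a s :
  is_derive s (1 : R) (fun t => mean (tilt J a t) (pair_form a))
   (mean (tilt J a s)
     (fun x => (pair_form a x - mean (tilt J a s) (pair_form a)) ^+ 2)).
Proof.
set f := pair_form a.
(* Unnormalised moments of orders 0, 1 and 2, each the derivative in t of the preceding one; the
   quotient rule for N / D then produces the variance. *)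
pose D t := \sum_x weight J x * expR (t * f x).
pose N t := \sum_x weight J x * f x * expR (t * f x).
pose S t := \sum_x weight J x * f x ^+ 2 * expR (t * f x).
have D0 : D s != 0.
  rewrite gt_eqF// /D (bigD1 [ffun=> true])//= ltr_wpDr ?mulr_gt0 ?expR_gt0//.
  by apply: sumr_ge0 => x _; rewrite mulr_ge0 ?expR_ge0.
have dexp x : is_derive s (1 : R) (fun t => expR (t * f x))
    (f x * expR (s * f x)).
  have dl : is_derive s (1 : R) (fun t : R => t * f x) (f x).
    have := is_deriveM (is_derive_id s (1 : R)) (is_derive_cst (f x) s (1 : R)).
    by rewrite scaler0 add0r /GRing.scale/= mulr1.
  rewrite mulrC; exact: (is_derive1_comp (f := expR)).
have dD : is_derive s (1 : R) D (N s).
  apply: (is_derive_fsum (h := fun x t => weight J x * expR (t * f x))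
    (dh := fun x t => weight J x * f x * expR (t * f x))) => x.
  by rewrite -mulrA; exact: is_deriveZ.
have dN : is_derive s (1 : R) N (S s).
  apply: (is_derive_fsum (h := fun x t => weight J x * f x * expR (t * f x))
    (dh := fun x t => weight J x * f x ^+ 2 * expR (t * f x))) => x.
  by rewrite expr2 mulrA -mulrA; exact: is_deriveZ.
have dq := is_deriveM dN (is_deriveV D0 dD).
have mE t : mean (tilt J a t) f = N t / D t by exact: mean_tilt.
rewrite [X in is_derive _ _ X](funext mE).
apply: is_derive_eq.
rewrite mE mean_tilt -/(D s).
have -> : \sum_x weight J x * (f x - N s / D s) ^+ 2 * expR (s * f x)
    = S s - 2 * (N s / D s) * N s + (N s / D s) ^+ 2 * D s.
  rewrite /S /N /D !mulr_sumr -sumrB -big_split/=.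
  by apply: eq_bigr => x _; ring.
by rewrite /GRing.scale/=; field.
Qed.

(** Jensen's inequality, from the tangent line of exp at the mean. *)
Lemma expR_mean_le J (g : config V -> R) :
  expR (mean J g) <= mean J (fun x => expR (g x)).
Proof.
set m := mean J g.
have -> : expR m = mean J (fun x => expR m * (1 + (g x - m))).
  rewrite meanZ /mean; under eq_bigr do rewrite mulrDr mulr1 mulrBr.
  rewrite big_split/= sumrB sum_gibbs -mulr_suml sum_gibbs mul1r.
  by rewrite -/(mean J g) subrr addr0 mulr1.
apply: ler_sum => x _; rewrite ler_wpM2l ?gibbs_ge0//.
have -> : expR (g x) = expR m * expR (g x - m) by rewrite -expRD addrC subrK.
by rewrite ler_pM2l ?expR_gt0// expR_ge1Dx.
Qed.

(** The exponential moment is the reciprocal of the mean of exp(-s (f - m)) under the tilted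
    measure. Jensen there bounds it by exp(s (E_s f - m)), and the mean value theorem turns E_s f -
    m into s times a variance at an intermediate tilt. *)
Lemma mgf_pair_form J a (eta A s : R) : (0 < #|V|)%N -> 0 < eta ->
  dobrushin J eta -> (forall e, e \in node_pairs V -> `|a e| <= A) ->
  0 <= A -> 0 <= s -> 4 * s * A * #|V|%:R <= eta ->
  mean J (fun x => expR (s * (pair_form a x - mean J (pair_form a))))
  <= expR ((4 * s * A * #|V|%:R / eta) ^+ 2).
Proof.
move=> V0 eta0 Jeta aA A0 s0 sA; set f := pair_form a; set m := mean J f.
pose dm t := mean (tilt J a t) (fun x => (f x - mean (tilt J a t) f) ^+ 2).
have [t /[!in_itv]/= /andP[t0 ts]] : exists2 t, t \in `[0, s] &
    mean (tilt J a s) f - mean (tilt J a 0) f = dm t * (s - 0).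
  apply: (MVT_segment (f := fun t => mean (tilt J a t) f)) => //.
    by move=> t _; exact: is_derive_mean_tilt.
  apply: continuous_subspaceT => t; apply: differentiable_continuous.
  by have [/derivable1_diffP] := is_derive_mean_tilt J a t.
have -> : tilt J a 0 = J by apply: funext => e; rewrite /tilt mul0r addr0.
rewrite -/m subr0 => mvt.
(* The variance bound at Dobrushin constant eta / 2 reads 4 A^2 n^2 / (eta / 2)^2, whence the 4
   inside the square. *)
have dm_le : dm t <= (4 * A * #|V|%:R / eta) ^+ 2.
  have tA : 4 * t * A * #|V|%:R <= eta.
    by apply: le_trans sA; rewrite !ler_wpM2r// ler_pM2l.
  have eta2 : 0 < eta / 2 by rewrite divr_gt0.
  have := variance_pair_form V0 eta2 (dobrushin_tilt Jeta aA A0 t0 tA) aA.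
  rewrite -/(dm t) mulrC -ler_pdivlMr ?exprn_gt0// => /le_trans; apply.
  rewrite le_eqVlt; apply/orP; left; apply/eqP; field.
  by rewrite gt_eqF.
pose D := \sum_x weight J x * expR (s * f x).
have D0 : 0 < D.
  rewrite /D (bigD1 [ffun=> true])//= ltr_wpDr ?mulr_gt0 ?expR_gt0//.
  by apply: sumr_ge0 => x _; rewrite mulr_ge0 ?expR_ge0.
have Z0 := partition_fun_gt0 J.
have mgfE : mean J (fun x => expR (s * (f x - m)))
    = D / partition_fun J * expR (- (s * m)).
  rewrite /mean /D !mulr_suml; apply: eq_bigr => x _.
  by rewrite mulrBr expRB expRN /gibbs; ring.
have mgf'E : mean (tilt J a s) (fun x => expR (- s * (f x - m)))
    = partition_fun J / D * expR (s * m).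
  rewrite mean_tilt -/f -/D mulrAC; congr (_ / _).
  rewrite /partition_fun mulr_suml; apply: eq_bigr => x _.
  by rewrite -mulrA -expRD; congr (_ * expR _); ring.
have := expR_mean_le (tilt J a s) (fun x => - s * (f x - m)).
rewrite mgf'E.
have -> : mean (tilt J a s) (fun x => - s * (f x - m)) = - (dm t * s * s).
  rewrite -mvt meanZ {1}/mean; under eq_bigr do rewrite mulrBr.
  rewrite sumrB -mulr_suml sum_gibbs mul1r -/(mean _ f); ring.
have -> : partition_fun J / D * expR (s * m)
    = (mean J (fun x => expR (s * (f x - m))))^-1.
  by rewrite mgfE !invfM invrK expRN invrK mulrC [_ * D^-1]mulrC; ring.
rewrite expRN lef_pV2 ?posrE ?expR_gt0//; last first.
  by rewrite mgfE !mulr_gt0 ?invr_gt0 ?expR_gt0.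
move=> /le_trans; apply; rewrite ler_expR.
have -> : (4 * s * A * #|V|%:R / eta) ^+ 2
    = (4 * A * #|V|%:R / eta) ^+ 2 * s * s by ring.
by rewrite !ler_wpM2r.
Qed.

Lemma tail_pair_form J a (eta A s r : R) : (0 < #|V|)%N -> 0 < eta ->
  dobrushin J eta -> (forall e, e \in node_pairs V -> `|a e| <= A) ->
  0 <= A -> 0 <= s -> 4 * s * A * #|V|%:R <= eta ->
  \sum_(x | r <= pair_form a x - mean J (pair_form a)) gibbs J x
  <= expR ((4 * s * A * #|V|%:R / eta) ^+ 2 - s * r).
Proof.
move=> V0 eta0 Jeta aA A0 s0 sA.
rewrite expRB ler_pdivlMr ?expR_gt0// mulr_suml.
apply: le_trans (mgf_pair_form V0 eta0 Jeta aA A0 s0 sA).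
rewrite big_mkcond/=; apply: ler_sum => x _.
case: ifP => [rx|_]; last by rewrite mulr_ge0 ?gibbs_ge0 ?expR_ge0.
by rewrite ler_wpM2l ?gibbs_ge0// ler_expR ler_wpM2l.
Qed.

Lemma pair_formN a x : pair_form (fun e => - a e) x = - pair_form a x.
Proof. by rewrite -sumrN; apply: eq_bigr => e _; rewrite mulNr. Qed.

(** The lower tail for [a] is the upper tail for its negative, which obeys the same bound [A]. *)
Lemma two_sided_tail_pair_form J a (eta A s r : R) : (0 < #|V|)%N -> 0 < eta ->
  dobrushin J eta -> (forall e, e \in node_pairs V -> `|a e| <= A) ->
  0 <= A -> 0 <= s -> 4 * s * A * #|V|%:R <= eta ->
  \sum_(x | r <= `|pair_form a x - mean J (pair_form a)|) gibbs J x
  <= 2 * expR ((4 * s * A * #|V|%:R / eta) ^+ 2 - s * r).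
Proof.
move=> V0 eta0 Jeta aA A0 s0 sA.
have up := tail_pair_form r V0 eta0 Jeta aA A0 s0 sA.
have naA e : e \in node_pairs V -> `|- a e| <= A by move=> ?; rewrite normrN aA.
have lo := tail_pair_form r V0 eta0 Jeta naA A0 s0 sA.
have nm : mean J (pair_form (fun e => - a e)) = - mean J (pair_form a).
  by rewrite -sumrN; apply: eq_bigr => x _; rewrite pair_formN mulrN.
rewrite nm in lo; rewrite mulr_natl mulr2n; apply: le_trans (lerD up lo).
rewrite !(big_mkcond (fun x => r <= _))/= -big_split; apply: ler_sum => x _ /=.
rewrite pair_formN -opprD ler_normr; have := gibbs_ge0 J x.
by case: (r <= _); case: (r <= _) => /= g0; lra.
Qed.

End Perturbation.

(** * The Ising model without external field as a Gibbs measure *)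

Section IsingModel.
Variables (R : realType) (V : finType) (p : ising R V).

(** Extension by zero turns the sum over edges into a form over all pairs. *)
Definition edge_weight (e : {set V}) : R :=
  if e \in edges (graph p) then edge_param p e else 0.

Lemma ising_pmf_gibbs : no_external_field p -> ising_pmf p =1 gibbs edge_weight.
Proof.
move=> p0.
have HE x : hamiltonian p x = pair_form edge_weight x.
  rewrite /hamiltonian big1 ?add0r => [|v _]; last by rewrite p0 mul0r.
  rewrite /pair_form big_mkcond [RHS]big_mkcond/=; apply: eq_bigr => e _.
  have /subsetP/(_ e) := edges_sub (graph p); rewrite /edge_weight.
  by case: ifP => [_ ->//|_ _]; case: ifP => _; rewrite ?mul0r.
move=> x; rewrite /ising_pmf /log_partition HE.
under [X in ln X]eq_bigr do rewrite HE.
by rewrite expRB lnK// posrE partition_fun_gt0.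
Qed.

Lemma high_temperature_dobrushin eta :
  high_temperature eta p -> dobrushin edge_weight eta.
Proof.
move=> [_ tp] v; apply: le_trans tp.
exact: (le_bigmax _ (fun v => \sum_(u | u != v) tanh `|coupling p u v|)).
Qed.

End IsingModel.

Theorem theorem2 (R : realType) (V : finType) (n : nat) (hn : #|V| = n)
    (hn2 : (2 <= n)%N) (p : ising R V) (eta : R)
    (hfield : no_external_field p) (htemp : high_temperature eta p)
    (a : {set V} -> R) (ha : exists2 e, e \in node_pairs V & a e != 0)
    (r : R)
    (hr : 300 * coef_norm a * n%:R * ln (n%:R : R) ^+ 2 / eta + 2 <= r) :
  Prob p (fun x => r <= `|pair_form a x - Expect p (pair_form a)|)
    <= 5 * expR (- (eta * r / (1735 * coef_norm a * n%:R * ln (n%:R : R)))).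
Proof.
have eta0 : 0 < eta by case: htemp.
have aA e : e \in node_pairs V -> `|a e| <= coef_norm a.
  exact: (le_bigmax_cond _ (fun e => `|a e|)).
have A0 : 0 < coef_norm a.
  by have [e eP ae] := ha; apply: lt_le_trans (aA e eP); rewrite normr_gt0.
have V0 : (0 < #|V|)%N by rewrite hn (leq_trans _ hn2).
have n2 : 2 <= n%:R :> R by rewrite ler_nat.
have n0 : 0 < n%:R :> R by apply: lt_le_trans n2.
(* From ln(1/n) <= 1/n - 1 <= -1/2. *)
have L : 1 / 2 <= ln (n%:R : R).
  have nV : n%:R^-1 <= 2^-1 :> R by rewrite lef_pV2 ?posrE.
  have nV0 : 0 < n%:R^-1 :> R by rewrite invr_gt0.
  have := @le_ln1Dx R (n%:R^-1 - 1).
  by rewrite [1 + _]addrC subrK lnV ?posrE// => /(_ _); lra.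
have r0 : 0 <= r.
  apply: le_trans hr; rewrite addr_ge0// divr_ge0//; last exact: ltW.
  by rewrite mulr_ge0 ?sqr_ge0// ltW// !mulr_gt0.
set A := coef_norm a in aA A0 hr *.
have pE := ising_pmf_gibbs hfield.
have EE : Expect p (pair_form a) = mean (edge_weight p) (pair_form a).
  by apply: eq_bigr => x _; rewrite pE.
rewrite /Prob EE; under eq_bigr do rewrite pE.
(* This makes 4 s A n equal to eta / 2, within the admissible range, and the quadratic term of the
   exponent equal to 1/4. *)
pose s := eta / (8 * A * n%:R).
have sE : 4 * s * A * n%:R = eta / 2 by rewrite /s; field; rewrite !gt_eqF.
have s0 : 0 <= s by rewrite divr_ge0 ?ltW// !mulr_gt0.
have := two_sided_tail_pair_form r V0 eta0 (high_temperature_dobrushin htemp)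
  aA (ltW A0) s0.
rewrite hn sE => /(_ _)/le_trans; apply; first lra.
have -> : (eta / 2 / eta) ^+ 2 = 1 / 4 by field; rewrite gt_eqF.
rewrite expRD mulrA; apply: ler_pM.
- by rewrite mulr_ge0 ?expR_ge0.
- exact: expR_ge0.
(* Since exp(-1/4) >= 3/4, the prefactor 2 exp(1/4) is at most 8/3, below 5. *)
- have := expR_ge1Dx (- (1 / 4) : R); rewrite expRN.
  have e0 := expR_gt0 (1 / 4 : R).
  by rewrite -[X in _ <= X]mul1r ler_pdivlMr//; lra.
rewrite ler_expR lerN2 /s [leRHS]mulrAC.
apply: ler_wpM2l; first by rewrite mulr_ge0// ltW.
rewrite lef_pV2 ?posrE ?mulr_gt0//; last by lra.
(* As ln n >= 1/2, the factor 1735 ln n exceeds the 8 in the denominator of [s]. *)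
have := ler_wpM2l (ltW (mulr_gt0 A0 n0)) L; nra.
Qed.
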